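(* Let $\Gamma=(\mathbb V,E)$ be a connected graph with countably infinite vertex set and uniformly bounded vertex degrees, with graph metric $d(\cdot,\cdot)$, and suppose there are constants $z\ge1$ and $C_U>0$ with $$\#\{y\in\mathbb V:d(x,y)\le r\}\le C_Ur^z\qquad\text{for all }x\in\mathbb V,\ r\in\mathbb N=\{1,2,\dots\}.$$ Let $\mathcal A$ be a collection of nonempty finite subsets of $\mathbb V$, and for each $A\in\mathcal A$ let $H_A$ be a (strictly) positive bounded self-adjoint operator on $\ell^2(A)$. Let $\lambda_A>0$ be the smallest eigenvalue of $H_A$, and $u_A(x)=(H_A^{-1}\mathbf 1_A)(x)$, $x\in A$. Suppose that $\langle x|H_A^{-1}|y\rangle\ge0$ for all $A\in\mathcal A$ and $x,y\in A$. Then for every $A\in\mathcal A$, $$\lambda_A\|u_A\|_\infty\ge1.$$ If, in addition, there are constants $c_1,\dots,c_5>0$ such that for all $A\in\mathcal A$, all $t>0$ and all $x,y\in A$, $$|\langle x|e^{-tH_A}|y\rangle|\le\begin{cases}c_1t^{-z/2}\exp(-c_2d(x,y)^2/t), & d(x,y)\ge1\text{ and }t\ge d(x,y),\\ c_3\exp(-c_4d(x,y)), & d(x,y)\ge1\text{ and }t<d(x,y),\\ c_5t^{-z/2}, & x=y,\end{cases}$$ then there is a constant $C<\infty$ depending only on $C_U,z$ and $c_1,\dots,c_5$ such that for every $A\in\mathcal A$, $$\lambda_A\|u_A\|_\infty\le C.$$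
   Context: Graphs are simple (no loops or multiple edges); $\deg(x)$ is the number of neighbors of $x$ in $\Gamma$; $d(x,y)$ is the length of a shortest path. $\ell^2(A)$ is the space of functions on $A$ with the weighted inner product $(f,g)_\mu=\sum_{x\in A}f(x)g(x)\deg(x)$, and self-adjointness and positivity are with respect to it. Matrix elements: $\langle x|L|y\rangle=(L\mathbf 1_y)(x)$, where $\mathbf 1_y$ is the indicator function of $\{y\}$; $\mathbf 1_A$ is the constant function $1$ on $A$. $\|f\|_\infty=\max_{x\in A}|f(x)|$. *)

(* Defs.v *)
From HB Require Import structures.
From mathcomp Require Import all_boot all_order all_algebra finmap.
From mathcomp Require Import all_classical all_reals all_analysis.

Set Implicit Arguments.
Unset Strict Implicit.
Unset Printing Implicit Defensive.

Import Order.TTheory GRing.Theory Num.Theory.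
Import numFieldNormedType.Exports.

Local Open Scope classical_set_scope.
Local Open Scope ring_scope.

Section Graphs.
Context {V : countType}.
Implicit Types (e : rel V) (x y : V).

Definition card_le {R : realType} (S : set V) (b : R) : Prop :=
  finite_set S /\ (#|` fset_set S|)%:R <= b.

Definition simple_graph e : Prop := symmetric e /\ irreflexive e.

Definition joins e x y (p : seq V) : Prop := path e x p /\ last x p = y.

Definition connected_graph e : Prop := forall x y, exists p, joins e x y p.

Definition deg e x : nat := #|` fset_set [set y | e x y]|.

Definition bounded_degree (R : realType) e : Prop :=
  exists D : R, forall x, card_le [set y | e x y] D.

(* [0] when [y] is not reachable from [x]. *)
Definition dist e x y : nat :=
  xget 0%N [set n | (exists2 p, joins e x y p & size p = n) /\
                    (forall p, joins e x y p -> (n <= size p)%N)].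

Definition ball_growth {R : realType} e (CU z : R) : Prop :=
  forall x (r : nat), (1 <= r)%N ->
    card_le [set y | (dist e x y <= r)%N] (CU * r%:R `^ z).

End Graphs.

(* The inner product of l^2(A) depends on the ambient graph (through [deg]), so
   it is not part of the carrier. Every linear operator is bounded here. *)
Notation l2 R A := {ffun A -> R^o}.

Section Operators.
Context {R : realType} {V : countType} {A : {fset V}}.
Implicit Types (e : rel V) (f g : l2 R A) (T : 'End(l2 R A)).

Definition inner e f g : R := \sum_(x : A) f x * g x * (deg e (val x))%:R.

Definition self_adjoint e T : Prop :=
  forall f g, inner e (T f) g = inner e f (T g).

Definition positive_op e T : Prop :=
  forall f, f != 0 -> 0 < inner e (T f) f.

Definition indic (y : A) : l2 R A := [ffun x => (x == y)%:R].

Definition one_fun : l2 R A := [ffun=> 1].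

Definition mxelt (x : A) (L : l2 R A -> l2 R A) (y : A) : R := L (indic y) x.

(* The values are nonnegative, so starting the maximum at 0 is harmless. *)
Definition supnorm f : R := \big[Num.max/0]_(x : A) `|f x|.

(* [0] if there is no smallest eigenvalue; never the case for self-adjoint
   [T] when [A] is nonempty and all degrees in [A] are positive. *)
Definition smallest_eigenvalue T : R :=
  xget 0 [set a : R | passmx.leigenvalue T a /\
                      forall b, passmx.leigenvalue T b -> a <= b].

Definition landscape T : l2 R A := (T^-1)%VF one_fun.

Definition exp_op T : l2 R A -> l2 R A := fun f =>
  [ffun x => limn (series (fun n : nat => (n`!)%:R^-1 * (iter n T f) x))].

Definition heat_kernel_bound e (z c1 c2 c3 c4 c5 : R) T : Prop :=
  forall (t : R) (x y : A), 0 < t ->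
    let k := `|mxelt x (exp_op (- t *: T)) y| in
    let d := dist e (val x) (val y) in
    [/\ (1 <= d)%N -> d%:R <= t ->
          k <= c1 * t `^ (- z / 2) * expR (- c2 * d%:R ^+ 2 / t),
        (1 <= d)%N -> t < d%:R -> k <= c3 * expR (- c4 * d%:R)
      & x = y -> k <= c5 * t `^ (- z / 2)].

End Operators.

(* The degree bound is existential, so that constants depending only on [z]
   and [CU] are uniform over it. *)
Record setting {R : realType} (z CU : R) (V : countType) (e : rel V)
    (AA : set {fset V}) (H : forall A : {fset V}, 'End(l2 R A)) : Prop := {
  infinite_vertices : infinite_set [set: V] ;
  edges_simple : simple_graph e ;
  edges_connected : connected_graph e ;
  edges_bounded : bounded_degree R e ;
  balls_growth : ball_growth e CU z ;
  sets_nonempty : forall A, AA A -> A != fset0 ;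
  H_self_adjoint : forall A, AA A -> self_adjoint e (H A) ;
  H_positive : forall A, AA A -> positive_op e (H A) ;
  H_inv_ge0 : forall A, AA A ->
    forall x y : A, 0 <= mxelt x (H A)^-1%VF y
}.

(* Main.v *)
(* Lower bound: since [H^-1] has nonnegative entries, an eigenvector [v] for the
   eigenvalue [l] satisfies [|v| / l <= H^-1 |v| <= supnorm v * u].

   Upper bound: the heat kernel is a combination of the eigenvectors of [H], so
   [k_t(x,x) <= exp(- l t / 2) k_(t/2)(x,x)], and off-diagonal entries are
   dominated by diagonal ones.  The geometric mean of this decay with the assumed
   Gaussian bound gives [sum_y |k_t(x,y)| <= M exp(- l t / 4)] for all [t > 0],
   where the spatial sum is controlled by volume growth at scale [sqrt t].
   Because [H u = 1], the mean value theorem yields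
   [supnorm (u - exp(-tH) u) <= t M], while for [t = 8 M / l] one has
   [supnorm (exp(-tH) u) <= supnorm u / 2]; hence [l supnorm u <= 16 M^2]. *)
Require Import Defs.
From HB Require Import structures.
From mathcomp Require Import all_boot all_order all_algebra finmap.
From mathcomp Require Import all_classical all_reals all_analysis.
From mathcomp Require Import ring lra.
From mathcomp Require complex.

Set Implicit Arguments.
Unset Strict Implicit.
Unset Printing Implicit Defensive.

Import Order.TTheory GRing.Theory Num.Theory.
Import numFieldNormedType.Exports.

Local Open Scope classical_set_scope.
Local Open Scope ring_scope.

(** * Spectral decomposition of self-adjoint operators *)

Section SymmetricMatrix.
Import complex.
Variable R : rcfType.

(* The real and imaginary parts of a unitary eigenbasis are eigenvectors as
   well; they need not be independent, but they still resolve the identity. *)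
Lemma symmetric_eigenframe n (B : 'M[R]_n) : B^T = B ->
  exists (Q : 'M[R]_(n + n, n)) (d : 'rV[R]_(n + n)),
    Q *m B = diag_mx d *m Q /\ Q^T *m Q = 1%:M.
Proof.
move=> symB.
pose Bc : 'M[R[i]]_n := map_mx (real_complex R) B.
have Bc_herm : Bc \is hermsymmx.
  apply: realsym_hermsym; last first.
    by apply/mxOverP => i j; rewrite mxE; apply/complex_realP; exists (B i j).
  by apply/is_hermitianmxP; rewrite expr0 scale1r map_mx_id // /Bc map_trmx symB.
have /orthomx_spectralP := hermitian_normalmx Bc_herm.
have /mxOverP dreal := hermitian_spectral_diag_real Bc_herm.
set P := spectralmx Bc; set dc := spectral_diag Bc => eqB.
have Pu : P \is unitarymx by exact: spectral_unitarymx.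
have eqP : P *m Bc = diag_mx dc *m P.
  by rewrite [in LHS]eqB -mulmxA mulKVmx // unitarymx_unit.
have PP : (map_mx Num.conj P^T) *m P = 1%:M.
  by rewrite -invmx_unitary // mulVmx // unitarymx_unit.
pose Pr := map_mx (@complex.Re R) P; pose Pi := map_mx (@complex.Im R) P.
pose d := map_mx (@complex.Re R) dc.
exists (col_mx Pr Pi), (row_mx d d); split.
  (* The eigenvalues are real, so [P *m Bc = diag_mx dc *m P] splits into its real and imaginary
     parts. *)
  rewrite mul_col_mx diag_mx_row mul_block_col !mul0mx addr0 add0r.
  have dE j : dc 0 j = real_complex R (d 0 j).
    by rewrite mxE; have /complex_realP[x ->] := dreal 0 j.
  congr col_mx; apply/matrixP => i j; have /matrixP/(_ i j) := eqP.
  1,2: rewrite !mul_diag_mx !mxE dE ?mxE.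
    move=> /(congr1 (@complex.Re R)); rewrite raddf_sum /= => H.
    transitivity (complex.Re ((real_complex R (complex.Re (dc 0 i))) * P i j)).
      rewrite -H; apply: eq_bigr => k _; rewrite !mxE.
      by case: (P i k) => a b /=; rewrite mulr0 subr0.
    by case: (P i j) => a b /=; rewrite mul0r subr0.
  move=> /(congr1 (@complex.Im R)); rewrite raddf_sum /= => H.
  transitivity (complex.Im ((real_complex R (complex.Re (dc 0 i))) * P i j)).
    rewrite -H; apply: eq_bigr => k _; rewrite !mxE.
    by case: (P i k) => a b /=; rewrite mulr0 add0r.
  by case: (P i j) => a b /=; rewrite mul0r addr0.
(* The real part of the unitarity relation [PP] is [Pr^T *m Pr + Pi^T *m Pi = 1]. *)
rewrite tr_col_mx mul_row_col; apply/matrixP => i j.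
have /matrixP/(_ i j) := PP; rewrite !mxE => /(congr1 (@complex.Re R)).
rewrite raddf_sum /= -big_split /= => H.
transitivity (complex.Re ((i == j)%:R : R[i])); last by case: (i == j).
rewrite -H; apply: eq_bigr => k _; rewrite !mxE.
by case: (P k i) => a b; case: (P k j) => a' b' /=; rewrite mulNr opprK.
Qed.

End SymmetricMatrix.

Section L2.
Context {R : realType} {V : countType} {A : {fset V}}.
Implicit Types (f g : l2 R A) (T : 'End(l2 R A)).

Lemma indicE (y x : A) : (Defs.indic y : l2 R A) x = (x == y)%:R.
Proof. by rewrite ffunE. Qed.

Lemma l2P f g : (forall x, f x = g x :> R) -> f = g.
Proof. by move=> fg; apply/ffunP. Qed.

Lemma l2ZE a f x : (a *: f) x = a * f x :> R.
Proof. by rewrite ffunE. Qed.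

Lemma l2_sumE I (r : seq I) (P : pred I) (F : I -> l2 R A) x :
  (\sum_(i <- r | P i) F i) x = \sum_(i <- r | P i) F i x :> R.
Proof. exact: sum_ffunE. Qed.

Lemma l2_indicE f : f = \sum_y f y *: Defs.indic y.
Proof.
apply/ffunP => x; rewrite sum_ffunE (bigD1 x) //= big1 => [|y yx].
  by rewrite addr0 !ffunE eqxx [_ *: _]mulr1.
by rewrite !ffunE eq_sym (negPf yx) [_ *: _]mulr0.
Qed.

Lemma mxelt_sum T f x : T f x = \sum_y mxelt x T y * f y.
Proof.
rewrite [in LHS](l2_indicE f) linear_sum sum_ffunE; apply: eq_bigr => y _.
by rewrite linearZ ffunE [LHS]mulrC.
Qed.

Lemma innerC e f g : inner e f g = inner e g f.
Proof. by apply: eq_bigr => x _; rewrite [f x * _]mulrC. Qed.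

Lemma innerZl e a f g : inner e (a *: f) g = a * inner e f g.
Proof.
by rewrite mulr_sumr; apply: eq_bigr => x _; rewrite ffunE [_ *: _]/(a * f x) !mulrA.
Qed.

Lemma innerZr e a f g : inner e f (a *: g) = a * inner e f g.
Proof. by rewrite innerC innerZl innerC. Qed.

Lemma inner_indic e (y : A) f : inner e (Defs.indic y) f = f y * (deg e (val y))%:R.
Proof.
rewrite /inner (bigD1 y) //= big1 => [|x xy]; first by rewrite indicE eqxx mul1r addr0.
by rewrite indicE (negPf xy) !mul0r.
Qed.

Lemma supnorm_ge f x : `|f x| <= supnorm f.
Proof. exact: le_bigmax. Qed.

Lemma supnorm_le f b : 0 <= b -> (forall x, `|f x| <= b) -> supnorm f <= b.
Proof. by move=> b0 fb; apply/bigmax_leP; split. Qed.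

Lemma supnorm_ge0 f : 0 <= supnorm f.
Proof. exact: bigmax_ge_id. Qed.

(** Conjugation by the square root of the degree makes the matrix of [T] symmetric; dividing the
    rows of its eigenframe by that root gives eigenfunctions. There are twice as many as points of
    [A]: a tight frame, possibly with zero vectors, instead of a basis. *)
Lemma self_adjoint_eigenframe e T :
  (forall x : A, (0 < deg e (val x))%N) -> self_adjoint e T ->
  exists (I : finType) (phi : I -> l2 R A) (lam : I -> R),
    (forall i, T (phi i) = lam i *: phi i) /\
    (forall f, f = \sum_i inner e f (phi i) *: phi i).
Proof.
move=> deg_gt0 saT.
pose s (x : A) : R := Num.sqrt (deg e (val x))%:R.
have s_gt0 x : 0 < s x by rewrite sqrtr_gt0 ltr0n.
have s_neq0 x : s x != 0 by rewrite gt_eqF.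
have ss x : s x * s x = (deg e (val x))%:R by rewrite -expr2 sqr_sqrtr.
(* Self-adjointness tested on two indicators: detailed balance with the degrees as weights. *)
have Mtr x y : mxelt x T y = s y * s y * mxelt y T x / (s x * s x).
  apply: (canRL (mulfK _)); first by rewrite mulf_neq0.
  have := saT (Defs.indic y) (Defs.indic x); rewrite inner_indic innerC inner_indic !ss.
  by rewrite /mxelt => ->; rewrite mulrC.
pose B : 'M[R]_#|{: A}| := \matrix_(i, j)
  (s (enum_val i) * mxelt (enum_val i) T (enum_val j) / s (enum_val j)).
have [|Q [d [QB QQ]]] := @symmetric_eigenframe R _ B.
  apply/matrixP => i j; rewrite !mxE.
  set x := enum_val i; set y := enum_val j.
  by rewrite (Mtr x y); field; rewrite !s_neq0.
pose r := @enum_rank (A : finType).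
exists 'I_(#|{: A}| + #|{: A}|)%N, (fun k => [ffun x => Q k (r x) / s x]), (fun k => d 0 k).
split=> [k|f]; apply: l2P => x.
  rewrite mxelt_sum l2ZE !ffunE; apply: (mulfI (s_neq0 x)).
  transitivity (d 0 k * Q k (r x)); last by field; rewrite s_neq0.
  have /matrixP/(_ k (r x)) := QB; rewrite mul_diag_mx !mxE => <-.
  rewrite mulr_sumr [RHS](reindex r) /=; last first.
    by apply: onW_bij; exact: enum_rank_bij.
  apply: eq_bigr => y _; rewrite mxE !enum_rankK ffunE.
  by rewrite (Mtr x y); field; rewrite !s_neq0.
rewrite l2_sumE.
under eq_bigr => k _ do rewrite l2ZE !ffunE mulr_suml.
(* The inner sum over [k] is now an entry of [Q^T *m Q = 1], up to weights, so only [y = x]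
   survives. *)
rewrite exchange_big /= (bigD1 x) //= [X in _ + X]big1 => [|y yx].
  have /matrixP/(_ (r x) (r x)) := QQ; rewrite !mxE eqxx.
  move=> /(congr1 (fun a => f x * a)); rewrite mulr1 addr0 => E.
  rewrite -[LHS]E mulr_sumr; apply: eq_bigr => k _.
  by rewrite mxE ffunE -ss; field; rewrite s_neq0.
have /matrixP/(_ (r y) (r x)) := QQ; rewrite !mxE (inj_eq enum_rank_inj) (negPf yx).
move=> /(congr1 (fun a => f y * s y / s x * a)); rewrite mulr0 => E.
rewrite -[RHS]E mulr_sumr; apply: eq_bigr => k _.
by rewrite mxE ffunE -ss; field; rewrite !s_neq0.
Qed.
End L2.

Definition heat_op {R : realType} {V : countType} {A : {fset V}}
    (T : 'End(l2 R A)) (t : R) : l2 R A -> l2 R A := exp_op (- t *: T).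

Section Spectral.
Context {R : realType} {V : countType} {A : {fset V}}.
Implicit Types (f g : l2 R A).
Variables (e : rel V) (T : 'End(l2 R A)).
Variables (I : finType) (phi : I -> l2 R A) (lam : I -> R).
Hypothesis saT : self_adjoint e T.
Hypothesis phiP : forall i, T (phi i) = lam i *: phi i.
Hypothesis frame : forall f, f = \sum_i inner e f (phi i) *: phi i.

Lemma frame_coefT f i : inner e (T f) (phi i) = lam i * inner e f (phi i).
Proof. by rewrite saT phiP innerZr. Qed.

(** Each term of the expansion of [f] is scaled by [T], so the exponential series acts on it as a
    scalar series. An overcomplete frame is enough for this. *)
Lemma frame_heat_op t f x : heat_op T t f x =
  \sum_i expR (- t * lam i) * inner e f (phi i) * phi i x.
Proof.
have iterE n : iter n (- t *: T) f =
    \sum_i ((- t * lam i) ^+ n * inner e f (phi i)) *: phi i.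
  elim: n => [|n IHn] /=.
    by rewrite [LHS]frame; apply: eq_bigr => i _; rewrite expr0 mul1r.
  rewrite IHn linear_sum; apply: eq_bigr => i _.
  rewrite linearZ /= scale_lfunE phiP !scalerA exprSr; congr (_ *: _).
  by rewrite -!mulrA; congr (_ * _); rewrite mulrCA; ring.
rewrite /heat_op ffunE; apply: cvg_lim => //.
have -> : series (fun n => n`!%:R^-1 * iter n (- t *: T) f x) =
    (fun n => \sum_i series (exp_coeff (- t * lam i)) n *
                     (inner e f (phi i) * phi i x)).
  apply/funext => n; rewrite /series /=.
  under [RHS]eq_bigr => i _ do rewrite mulr_suml.
  rewrite exchange_big /=; apply: eq_bigr => k _.
  rewrite iterE l2_sumE mulr_sumr; apply: eq_bigr => i _.
  by rewrite l2ZE /exp_coeff /=; ring.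
under [X in _ --> X]eq_bigr => i _ do rewrite -mulrA.
apply: cvg_big => [|i _]; first exact: add_continuous.
by apply: cvgMr_tmp; exact: is_cvg_series_exp_coeff.
Qed.

Lemma leigenvalueP (a : R) :
  reflect (exists2 f, f != 0 & T f = a *: f) (passmx.leigenvalue T a).
Proof.
apply: (iffP idP) => [|[f f0 Tf]].
  rewrite /passmx.leigenvalue -vpick0 => v0; exists (vpick (passmx.leigenspace T a)) => //.
  have := memv_pick (passmx.leigenspace T a).
  rewrite memv_ker add_lfunE opp_lfunE scale_lfunE id_lfunE subr_eq0.
  by move/eqP.
apply/negP => /eqP E; have : f \in passmx.leigenspace T a.
  by rewrite memv_ker add_lfunE opp_lfunE scale_lfunE id_lfunE Tf subrr.
by rewrite E memv0 (negPf f0).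
Qed.

(** If [phi i] is zero, [lam i] need not be an eigenvalue; this selects a true eigenvector that
    overlaps [f]. *)
Lemma frame_neq0 f : f != 0 -> exists2 i, phi i != 0 & inner e f (phi i) != 0.
Proof.
move=> f0; apply/not_exists2P => H; move/eqP: f0; apply; rewrite [LHS]frame.
apply: big1 => i _; case: (H i) => /negP; rewrite negbK => /eqP ->.
  by rewrite scaler0.
by rewrite scale0r.
Qed.

(** The eigenvalues are exactly the [lam i] with [phi i != 0], a nonempty finite family, so the
    default of [xget] is never reached. *)
Lemma smallest_eigenvalueP : A != fset0 ->
  passmx.leigenvalue T (smallest_eigenvalue T) /\
  (forall i, phi i != 0 -> smallest_eigenvalue T <= lam i).
Proof.
case/fset0Pn => x xA.
have one0 : (Defs.one_fun : l2 R A) != 0.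
  apply/eqP => /ffunP /(_ [` xA]%fset); rewrite !ffunE => /eqP.
  by rewrite oner_eq0.
have [i0 i0P _] := frame_neq0 one0.
have lamE i : phi i != 0 -> passmx.leigenvalue T (lam i).
  by move=> ?; apply/leigenvalueP; exists (phi i).
have [ev lev] : passmx.leigenvalue T (smallest_eigenvalue T) /\
    forall b, passmx.leigenvalue T b -> smallest_eigenvalue T <= b.
  apply: (@xgetPex _ 0 [set a : R | passmx.leigenvalue T a /\
                      forall b, passmx.leigenvalue T b -> a <= b]).
  case: (@arg_minP _ R I i0 [pred i | phi i != 0] lam i0P) => j jP jmin.
  exists (lam j); split=> [|b /leigenvalueP [f f0 Tf]]; first exact: lamE.
  (* The nonzero coefficient of [f] on [phi i] is multiplied by [b] and also by [lam i], hence
     [b = lam i]. *)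
  have [i iP] := frame_neq0 f0.
  have := frame_coefT f i; rewrite Tf innerZl => E fi.
  by rewrite (mulIf fi E); apply: jmin.
by split=> // i /lamE /lev.
Qed.

End Spectral.

(** * The heat semigroup *)

Lemma is_derive_bigsum (R : realType) (I : Type) (r : seq I) (F : I -> R -> R)
    (dF : I -> R) (t : R) : (forall i, is_derive t 1 (F i) (dF i)) ->
  is_derive t 1 (fun s => \sum_(i <- r) F i s) (\sum_(i <- r) dF i).
Proof.
move=> FP; elim: r => [|i r IHr].
  by under eq_fun do rewrite big_nil; rewrite big_nil; exact: is_derive_cst.
under eq_fun do rewrite big_cons.
by rewrite big_cons; exact: is_deriveD.
Qed.
Lemma is_derive_exp_term (R : realType) (a c t : R) :
  is_derive t 1 (fun s => expR (- s * a) * c) (- (a * (expR (- t * a) * c))).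
Proof.
have H : is_derive t 1 (fun s : R => - s * a) (- a).
  have -> : (fun s : R => - s * a) = (fun s => (- a) *: s).
    by apply/funext => s; rewrite mulNr mulrC -mulNr.
  by apply: is_derive_eq; rewrite [_ *: _]mulr1.
have H2 : is_derive t 1 (expR \o (fun s : R => - s * a)) (expR (- t * a) * - a).
  by apply: is_derive1_comp; exact: is_derive_expR.
have -> : (fun s => expR (- s * a) * c) = (fun s => c *: expR (- s * a)).
  by apply/funext => s; rewrite mulrC.
apply: (is_derive_eq (is_deriveZ c H2)).
suff : c * (expR (- t * a) * - a) = - (a * (expR (- t * a) * c)) by [].
by ring.
Qed.

(** * Positive operators and the lower bound *)

Section Positive.
Context {R : realType} {V : countType} {A : {fset V}}.
Variables (e : rel V) (T : 'End(l2 R A)).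
Hypothesis posT : positive_op e T.

(** Makes the total operation [T^-1] a genuine inverse. *)
Lemma positive_lker0 : lker T == 0%VS.
Proof.
rewrite -vpick0; apply/negPn/negP => /posT.
have := memv_pick (lker T); rewrite memv_ker => /eqP ->.
rewrite /inner big1 ?ltxx // => x _; by rewrite ffunE !mul0r.
Qed.

Lemma positive_eigenvalue_gt0 a : passmx.leigenvalue T a -> 0 < a.
Proof.
case/leigenvalueP => f /posT + Tf; rewrite Tf innerZl.
have ge0 : 0 <= inner e f f.
  by apply: sumr_ge0 => x _; rewrite -expr2 mulr_ge0 ?sqr_ge0.
have [->|ff0] := eqVneq (inner e f f) 0; first by rewrite mulr0 ltxx.
by rewrite pmulr_lgt0 // lt_neqAle eq_sym ff0.
Qed.

Lemma landscapeE x : landscape T x = \sum_y mxelt x T^-1%VF y.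
Proof. by rewrite mxelt_sum; apply: eq_bigr => y _; rewrite ffunE mulr1. Qed.

(** A nonnegative kernel attains its sup-norm operator bound at the constant function, so [T^-1] has
    norm [supnorm (landscape T)], which dominates its eigenvalue [a^-1]. *)
Lemma inv_eigenvalue_le_landscape a :
  (forall x y : A, 0 <= mxelt x T^-1%VF y) -> passmx.leigenvalue T a ->
  1 <= a * supnorm (landscape T).
Proof.
move=> G0 ev; have a0 := positive_eigenvalue_gt0 ev.
case/leigenvalueP: ev => v v0 Tv.
have Gv : (T^-1)%VF v = a^-1 *: v.
  rewrite -[in LHS](scalerK (lt0r_neq0 a0) v) -Tv linearZ /= lker0_lfunK //.
  exact: positive_lker0.
set S := supnorm (landscape T); have S0 : 0 <= S := supnorm_ge0 _.
have vS x : `|v x| <= a * S * supnorm v.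
  rewrite -mulrA -ler_pdivrMl //.
  have -> : a^-1 * `|v x| = `|(T^-1)%VF v x|.
    by rewrite Gv l2ZE normrM (gtr0_norm (x := a^-1)) // invr_gt0.
  rewrite mxelt_sum; apply: le_trans (ler_norm_sum _ _ _) _.
  apply: (@le_trans _ _ (\sum_y mxelt x T^-1%VF y * supnorm v)).
    apply: ler_sum => y _; rewrite normrM ger0_norm //.
    by apply: ler_wpM2l => //; exact: supnorm_ge.
  rewrite -mulr_suml -landscapeE; apply: ler_wpM2r; first exact: supnorm_ge0.
  by apply: le_trans (ler_norm _) _; exact: supnorm_ge.
have v_gt0 : 0 < supnorm v.
  rewrite lt_neqAle supnorm_ge0 eq_sym andbT; apply: contra v0 => /eqP vn.
  apply/eqP/l2P => x; apply/eqP; rewrite ffunE -normr_le0 -vn.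
  exact: supnorm_ge.
have := supnorm_le (mulr_ge0 (mulr_ge0 (ltW a0) S0) (ltW v_gt0)) vS.
by rewrite -{1}[supnorm v]mul1r ler_pM2r.
Qed.
End Positive.

(** * Spectral estimates of the heat kernel, and the landscape function *)

Definition heat_kernel {R : realType} {V : countType} {A : {fset V}}
    (T : 'End(l2 R A)) (t : R) (x y : A) : R :=
  mxelt x (heat_op T t) y.

Section HeatKernel.
Context {R : realType} {V : countType} {A : {fset V}}.
Implicit Types (f g : l2 R A) (x y : A) (s t l m B D M : R).
Variables (e : rel V) (T : 'End(l2 R A)).
Variables (I : finType) (phi : I -> l2 R A) (lam : I -> R).
Hypothesis saT : self_adjoint e T.
Hypothesis phiP : forall i, T (phi i) = lam i *: phi i.
Hypothesis frame : forall f, f = \sum_i inner e f (phi i) *: phi i.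
Local Notation w x := ((deg e (val x))%:R : R).
Local Notation heat := (heat_kernel T).

(** The weight [w y] comes from the coefficients of [indic y]; the kernel is symmetric only up to
    the degrees. *)
Lemma frame_heat t x y :
  heat t x y = \sum_i expR (- t * lam i) * (phi i y * w y) * phi i x.
Proof.
rewrite /heat_kernel /mxelt (frame_heat_op phiP frame).
by apply: eq_bigr => i _; rewrite inner_indic.
Qed.

Lemma heat_op_sum t f x : heat_op T t f x = \sum_y heat t x y * f y.
Proof.
rewrite (frame_heat_op phiP frame).
under [RHS]eq_bigr => y _ do rewrite frame_heat mulr_suml.
rewrite exchange_big /=; apply: eq_bigr => i _.
rewrite /inner mulr_sumr mulr_suml; apply: eq_bigr => y _; ring.
Qed.

Lemma heat0 x : heat 0 x x = 1.
Proof.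
rewrite frame_heat; have := frame (Defs.indic x).
move=> /(congr1 (fun f : l2 R A => f x : R)); rewrite indicE eqxx l2_sumE => E.
rewrite -[RHS]/(true%:R : R) E.
by apply: eq_bigr => i _; rewrite l2ZE inner_indic oppr0 mul0r expR0 mul1r.
Qed.

(** On the diagonal every term of the expansion is nonnegative, so the exponentials can be compared
    term by term. *)
Lemma heat_diag_decay l s t x : (forall i, phi i != 0 -> l <= lam i) -> s <= t ->
  heat t x x <= expR (- (t - s) * l) * heat s x x.
Proof.
move=> lP st; rewrite (frame_heat t) (frame_heat s).
rewrite mulr_sumr.
apply: ler_sum => i _.
have -> (a : R) : a * (phi i x * w x) * phi i x = a * (phi i x ^+ 2 * w x) by ring.
have -> (a b : R) : b * (a * (phi i x * w x) * phi i x) =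
  (b * a) * (phi i x ^+ 2 * w x) by ring.
have [->|/lP llam] := eqVneq (phi i) 0.
  by rewrite ffunE expr0n /= !mul0r !mulr0.
apply: ler_wpM2r; first by rewrite mulr_ge0 ?sqr_ge0.
rewrite -expRD ler_expR.
suff : (t - s) * l <= (t - s) * lam i by lra.
by apply: ler_wpM2l => //; rewrite subr_ge0.
Qed.

Lemma heat_diag_le l t x : (forall i, phi i != 0 -> l <= lam i) -> 0 <= t ->
  heat t x x <= expR (- t * l).
Proof. by move=> lP t0; have := heat_diag_decay x lP t0; rewrite heat0 mulr1 subr0. Qed.

Lemma heat_diag_ge0 t x : 0 <= heat t x x.
Proof.
rewrite frame_heat; apply: sumr_ge0 => i _.
have -> (a : R) : a * (phi i x * w x) * phi i x = a * (phi i x ^+ 2 * w x) by ring.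
by rewrite mulr_ge0 ?expR_ge0 // mulr_ge0 ?sqr_ge0.
Qed.

(* [|phi i x * phi i y| <= (phi i x ^+ 2 + phi i y ^+ 2) / 2], termwise in the
   eigenframe expansion, replaces Cauchy-Schwarz. *)
Lemma heat_offdiag_le t D m x y :
  (forall x : A, 1 <= w x) -> (forall x : A, w x <= D) ->
  (forall x, heat t x x <= m) -> `|heat t x y| <= D * m.
Proof.
move=> w1 wD hm; have w0 (z : A) : 0 < w z by exact: lt_le_trans ltr01 (w1 z).
pose q (z : A) : R := \sum_i expR (- t * lam i) * phi i z ^+ 2.
have q0 z : 0 <= q z by apply: sumr_ge0 => i _; rewrite mulr_ge0 ?expR_ge0 ?sqr_ge0.
(* [w z * q z] is the diagonal kernel itself. The bound [1 <= w z] lets the weight be dropped, and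
   the unmatched [w y] costs the factor [D]. *)
have hq z : w z * q z <= m.
  apply: le_trans (hm z); rewrite frame_heat mulr_sumr.
  by rewrite le_eqVlt; apply/predU1P; left; apply: eq_bigr => i _; ring.
have qm z : q z <= m.
  by apply: le_trans (hq z); rewrite -{1}[q z]mul1r; apply: ler_wpM2r.
rewrite frame_heat; apply: le_trans (ler_norm_sum _ _ _) _.
apply: (@le_trans _ _ (w y * ((q x + q y) / 2))).
  rewrite -big_split /= mulr_suml mulr_sumr; apply: ler_sum => i _.
  rewrite !normrM (ger0_norm (expR_ge0 _)) (ger0_norm (ltW (w0 y))).
  have : 0 <= expR (- t * lam i) * w y * (`|phi i x| - `|phi i y|) ^+ 2.
    by apply: mulr_ge0 (sqr_ge0 _); apply: mulr_ge0 (expR_ge0 _) (ltW _).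
  rewrite -[phi i x ^+ 2]real_normK ?num_real // -[phi i y ^+ 2]real_normK ?num_real //.
  nra.
apply: ler_pM; rewrite ?(ltW (w0 y)) ?wD //.
  by rewrite mulr_ge0 ?addr_ge0.
by have := qm x; have := qm y; lra.
Qed.

Lemma heat_op0 f x : heat_op T 0 f x = f x.
Proof.
rewrite (frame_heat_op phiP frame); transitivity ((\sum_i inner e f (phi i) *: phi i) x : R).
  by rewrite l2_sumE; apply: eq_bigr => i _; rewrite oppr0 mul0r expR0 mul1r l2ZE.
by rewrite -frame.
Qed.

Lemma is_derive_heat_op f x (t : R) : is_derive t (1 : R)
  (fun s => heat_op T s f x : R) (- heat_op T t (T f) x).
Proof.
have -> : (fun s => heat_op T s f x : R) =
    (fun s => \sum_i expR (- s * lam i) * (inner e f (phi i) * phi i x)).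
  apply/funext => s; rewrite (frame_heat_op phiP frame).
  by apply: eq_bigr => i _; rewrite mulrA.
rewrite (frame_heat_op phiP frame).
have -> : - (\sum_i expR (- t * lam i) * inner e (T f) (phi i) * phi i x) =
    \sum_i - (lam i * (expR (- t * lam i) * (inner e f (phi i) * phi i x))).
  rewrite -sumrN; apply: eq_bigr => i _.
  by rewrite (frame_coefT saT phiP); ring.
by apply: is_derive_bigsum => i; exact: is_derive_exp_term.
Qed.

Lemma heat_op_diff_le f x t B : 0 < t ->
  (forall s, 0 < s -> `|heat_op T s (T f) x| <= B) ->
  `|f x - heat_op T t f x| <= t * B.
Proof.
move=> t0 fB.
have [g gE] : exists g : R -> R, g = (fun s => heat_op T s f x) by eexists.
have gd s : is_derive s (1 : R) g (- heat_op T s (T f) x).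
  by rewrite gE; exact: is_derive_heat_op.
have g0 : g 0 = f x by rewrite gE; exact: heat_op0.
have gt : g t = heat_op T t f x by rewrite gE.
have [|c /[!in_itv] /= /andP[c0 ct] E] := MVT t0 (fun s _ => gd s).
  by apply: derivable_within_continuous => s _; exact: ex_derive.
rewrite -gt -g0 distrC E subr0 normrM normrN (gtr0_norm t0) mulrC.
by rewrite ler_pM2l // fB.
Qed.

(** The row sums bound the operator norm of [heat_op T t] for [supnorm]. Once this norm is at most
    1/2, [S <= t * M + S / 2] can be solved for [S]. *)
Lemma landscape_le l M : 0 < l -> 1 <= M -> lker T == 0%VS ->
  (forall t x, 0 < t -> \sum_y `|heat t x y| <= M * expR (- (t * l / 4))) ->
  supnorm (landscape T) <= 16 * M ^+ 2 / l.
Proof.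
move=> l0 M1 kerT heatM; set u := landscape T; set S := supnorm u.
have S0 : 0 <= S := supnorm_ge0 _.
have M0 : 0 < M by lra.
have Tu : T u = Defs.one_fun by exact: lker0_lfunVK.
(* The factor 8 gives [t * l / 4 = 2 * M], and [M * expR (- (2 * M)) <= M / (1 + 2 * M) <= 1 /
   2]. *)
have [t tE] : exists t, t = 8 * M / l by exists (8 * M / l).
have t0 : 0 < t by rewrite tE divr_gt0 // mulr_gt0.
have half : M * expR (- (t * l / 4)) <= 2^-1.
  have -> : t * l / 4 = 2 * M by rewrite tE; field; rewrite gt_eqF.
  rewrite expRN ler_pdivrMr ?expR_gt0 //.
  by have := expR_ge1Dx (2 * M); lra.
have expl f s x : 0 < s -> `|heat_op T s f x| <= M * expR (- (s * l / 4)) * supnorm f.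
  move=> s0; rewrite heat_op_sum; apply: le_trans (ler_norm_sum _ _ _) _.
  apply: (@le_trans _ _ (\sum_y `|heat s x y| * supnorm f)).
    by apply: ler_sum => y _; rewrite normrM ler_wpM2l ?supnorm_ge.
  by rewrite -mulr_suml ler_wpM2r ?supnorm_ge0 ?heatM.
have one1 : supnorm (Defs.one_fun : l2 R A) <= 1.
  by apply: supnorm_le => // x; rewrite ffunE normr1.
have ubound x : `|u x| <= t * M + S / 2.
  rewrite -[u x](subrK (heat_op T t u x)).
  apply: le_trans (ler_normD _ _) _; apply: lerD.
    apply: heat_op_diff_le => // s s0; rewrite Tu.
    apply: le_trans (expl _ _ _ s0) _; rewrite -[leRHS]mulr1; apply: ler_pM => //.
    - by rewrite mulr_ge0 ?expR_ge0 // ltW.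
    - exact: supnorm_ge0.
    - rewrite -[leRHS]mulr1 ler_pM2l // -expR0 ler_expR oppr_le0.
      by rewrite !mulr_ge0 // ltW.
  apply: le_trans (expl _ _ _ t0) _; rewrite -/S [leRHS]mulrC; exact: ler_wpM2r.
have : S <= t * M + S / 2.
  by apply: supnorm_le => //; rewrite addr_ge0 ?mulr_ge0 // ltW.
have -> : 16 * M ^+ 2 / l = 2 * (t * M) by rewrite tE; field; rewrite gt_eqF.
lra.
Qed.
End HeatKernel.

(** * Volume growth *)

Section GraphDistance.
Context {V : countType} (e : rel V).
Hypothesis conn : connected_graph e.

(** Connectedness rules out the default value 0 of [dist]. *)
Lemma distP x y : (exists2 p, joins e x y p & size p = dist e x y) /\
  (forall p, joins e x y p -> (dist e x y <= size p)%N).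
Proof.
apply: (@xgetPex _ 0%N [set n | (exists2 p, joins e x y p & size p = n) /\
                    (forall p, joins e x y p -> (n <= size p)%N)]).
have [p jp] := conn x y.
have ex : exists n, `[< exists2 p, joins e x y p & size p = n >].
  by exists (size p); apply/asboolP; exists p.
case: (ex_minnP ex) => n /asboolP nP nmin; exists n; split=> // q jq.
by apply: nmin; apply/asboolP; exists q.
Qed.

Lemma dist_eq0 x y : dist e x y = 0%N -> x = y.
Proof. by have [[p [_ <-] <-] _] := distP x y => /size0nil ->. Qed.

Lemma dist_edge x y : e x y -> (dist e x y <= 1)%N.
Proof.
move=> exy; have [_ /(_ [:: y])] := distP x y; apply.
by split; rewrite //= exy.
Qed.

(** The first step of a path to some other vertex is a neighbor. Finiteness of the neighborhood
    matters because [fset_set] of an infinite set is empty. *)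
Lemma deg_gt0 (R : realType) x : infinite_set [set: V] -> bounded_degree R e ->
  (0 < deg e x)%N.
Proof.
move=> Vinf [D /(_ x) [fin _]].
have [y xy] : exists y, y != x.
  apply: contra_notP Vinf => /forallNP H; apply: (@sub_finite_set _ _ [set x]).
    by move=> y _; have /negP := H y; rewrite negbK => /eqP.
  exact: finite_set1.
have [p [+ lastp]] := conn x y; case: p lastp => [/= E|v p _ /= /andP[exv _]].
  by rewrite E eqxx in xy.
by rewrite /deg cardfs_gt0; apply/fset0Pn; exists v; rewrite in_fset_set // inE.
Qed.

(** Neighbors lie in the ball of radius 1. Thus [CU] bounds the degrees, and the final constant does
    not involve the bound from [bounded_degree]. *)
Lemma deg_le (R : realType) (CU z : R) x : ball_growth e CU z -> (deg e x)%:R <= CU.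
Proof.
move=> /(_ x 1%N isT) [fin]; rewrite powR1 mulr1; apply: le_trans; rewrite ler_nat.
have sub : [set y | e x y] `<=` [set y | (dist e x y <= 1)%N] by exact: dist_edge.
have fin' := sub_finite_set sub fin.
by apply: fsubset_leq_card; apply/fsubsetP => y; rewrite !in_fset_set // !inE => /sub.
Qed.

End GraphDistance.

(** Telescoping: [1 / a ^ 2 <= 2 / a - 2 / (a + 1)] for [a >= 1]. *)
Lemma sum_inv_sqr_le (R : realType) N : \sum_(j < N) (j.+1%:R ^- 2 : R) <= 2.
Proof.
suff : \sum_(j < N) (j.+1%:R ^- 2 : R) <= 2 - 2 / N.+1%:R.
  by move=> /le_trans; apply; rewrite gerBl divr_ge0.
elim: N => [|N IHN]; first by rewrite big_ord0 invr1 mulr1 subrr.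
rewrite big_ord_recr /=; have N0 : 0 < N.+1%:R :> R by rewrite ltr0n.
have -> : N.+2%:R = N.+1%:R + 1 :> R by rewrite natr1.
have N1 : 1 <= N.+1%:R :> R by rewrite ler1n.
move: IHN N0 N1; move: (N.+1%:R) => a IHN a0 a1.
apply: (@le_trans _ _ (2 - 2 / a + a ^- 2)); first by rewrite lerD2r.
rewrite -subr_ge0.
have -> : 2 - 2 / (a + 1) - (2 - 2 / a + a ^- 2) = (a - 1) / (a ^+ 2 * (a + 1)).
  by field; rewrite !gt_eqF //; lra.
by rewrite divr_ge0 ?mulr_ge0 ?sqr_ge0 //; lra.
Qed.

(** Raise [y <= expR y] to the power [p = m + 2] at [y = c * (j + 1) / p]; the factor [expR c] in
    the constant pays for the shift from [j] to [j + 1]. *)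
Lemma exp_decay_poly (R : realType) (c : R) m : 0 < c ->
  exists2 K : R, 0 <= K &
    forall j : nat, j.+1%:R ^+ m * expR (- (c * j%:R)) <= K / j.+1%:R ^+ 2.
Proof.
move=> c0; pose p := m.+2; exists ((p%:R / c) ^+ p * expR c).
  by rewrite mulr_ge0 ?expR_ge0 ?exprn_ge0 ?divr_ge0 // ltW.
move=> j; have j0 : 0 < j.+1%:R :> R by rewrite ltr0n.
have p0 : 0 < p%:R :> R by rewrite ltr0n.
rewrite ler_pdivlMr ?exprn_gt0 // mulrAC -exprD addn2 -/p.
rewrite expRN ler_pdivrMr ?expR_gt0 // -mulrA -expRD.
have -> : c + c * j%:R = p%:R * (c * j.+1%:R / p%:R).
  by rewrite -[j.+1]addn1 natrD; field; rewrite gt_eqF.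
rewrite expRM_natl -exprMn lerXn2r
  ?nnegrE ?mulr_ge0 ?invr_ge0 ?expR_ge0 ?(ltW c0) ?(ltW j0) ?(ltW p0) //.
apply: (@le_trans _ _ (p%:R / c * (c * j.+1%:R / p%:R))).
  by rewrite le_eqVlt; apply/predU1P; left; field; rewrite !gt_eqF.
rewrite ler_pM2l ?divr_gt0 //; apply: le_trans (expR_ge1Dx _); lra.
Qed.

(** Cut [A] into shells of width [n]. Shell [j] lies in the ball of radius [(j + 1) * n], whose
    volume bound splits off [n ^ z]; the remaining sum over [j] converges uniformly in the graph,
    the set and [n]. *)
Lemma sum_ball_exp_le (R : realType) (c z CU : R) : 0 < c -> 0 < CU -> 0 <= z ->
  exists2 M : R, 0 <= M &
  forall (V : countType) (e : rel V) (A : {fset V}) x n, ball_growth e CU z ->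
    (0 < n)%N ->
    \sum_(y : A) expR (- (c * (dist e x (val y) %/ n)%:R)) <= M * n%:R `^ z.
Proof.
move=> c0 CU0 z0; pose m := (Num.truncn z).+1.
have zm : z <= m%:R by apply: ltW; exact: truncnS_gt.
have [K K0 KP] := exp_decay_poly m c0.
exists (CU * (K * 2)); first by rewrite !mulr_ge0 // ltW.
move=> V e A x n growth n0; pose q (y : A) := (dist e x (val y) %/ n)%N.
pose N := (\max_y q y).+1.
have qN y : (q y < N)%N by rewrite ltnS leq_bigmax.
rewrite (partition_big (fun y => Ordinal (qN y)) predT) //=.
apply: (@le_trans _ _ (\sum_(j < N) CU * n%:R `^ z * (K / j.+1%:R ^+ 2))); last first.
  rewrite -mulr_sumr -mulr_sumr.
  have := sum_inv_sqr_le R N; move: (\sum_(j < N) _) => s s2.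
  rewrite [CU * _ * _]mulrAC ler_wpM2r ?powR_ge0 //.
  by rewrite ler_wpM2l ?(ltW CU0) // ler_wpM2l.
apply: ler_sum => j _.
rewrite (eq_bigr (fun=> expR (- (c * j%:R)))); last by move=> y /eqP <-.
rewrite sumr_const -[leLHS]mulr_natl.
set P := (X in #|X|).
have jn0 : (1 <= j.+1 * n)%N by rewrite muln_gt0 n0.
have [fin card] := growth x _ jn0.
have cardP : #|P|%:R <= CU * (j.+1 * n)%:R `^ z.
  apply: le_trans card; rewrite ler_nat cardE -(size_map val).
  apply: uniq_leq_size.
    by rewrite map_inj_uniq ?enum_uniq //; exact: val_inj.
  move=> v /mapP [y]; rewrite mem_enum => /eqP yj ->.
  rewrite in_fset_set // inE /=; rewrite -yj /=.
  by rewrite ltnW // ltn_ceil.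
apply: (@le_trans _ _ (CU * (j.+1 * n)%:R `^ z * expR (- (c * j%:R)))).
  by rewrite ler_wpM2r ?expR_ge0.
rewrite natrM powRM // -!mulrA ler_wpM2l ?(ltW CU0) // [leLHS]mulrCA.
rewrite ler_wpM2l ?powR_ge0 //; apply: le_trans (KP j).
rewrite ler_wpM2r ?expR_ge0 // -powR_mulrn // ler_powR //.
by rewrite ler1n.
Qed.

(** * Summing the heat kernel *)

(** Geometric mean of two bounds; [a * b <= (a + b) ^ 2] avoids a square root of the constants. *)
Lemma le_mul_of_sqr (R : realFieldType) (k a b u v : R) :
  0 <= k -> 0 <= a -> 0 <= b -> 0 <= u -> 0 <= v ->
  k <= a * u ^+ 2 -> k <= b * v ^+ 2 -> k <= (a + b) * (u * v).
Proof.
move=> k0 a0 b0 u0 v0 kau kbv.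
have uv0 : 0 <= u * v by apply: mulr_ge0.
have ab0 : 0 <= a + b by apply: addr_ge0.
rewrite -(@ler_pXn2r _ 2) ?nnegrE ?mulr_ge0 //.
apply: (@le_trans _ _ (a * u ^+ 2 * (b * v ^+ 2))).
  by rewrite expr2; apply: ler_pM.
rewrite exprMn (_ : _ * _ = (a * b) * (u * v) ^+ 2); last by ring.
rewrite ler_wpM2r ?sqr_ge0 //.
have := mulr_ge0 a0 b0; have := sqr_ge0 a; have := sqr_ge0 b; nra.
Qed.

(** Volume growth needs integer radii. Rounding [sqrt t] up loses at most a factor 2, since
    [sqrt t >= 1]. *)
Lemma sqrt_scale (R : realType) (z t : R) : 0 <= z -> 1 <= t ->
  exists n : nat, [/\ (0 < n)%N, t <= n%:R ^+ 2 & t `^ (- z / 2) * n%:R `^ z <= 2 `^ z].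
Proof.
move=> z0 t1; have t0 : 0 <= t by lra.
have [s [s1 st]] : exists s : R, 1 <= s /\ t = s ^+ 2.
  exists (Num.sqrt t); rewrite sqr_sqrtr //; split=> //.
  by rewrite -sqrtr1 ler_sqrt.
have s0 : 0 < s by lra.
have lo := truncnS_gt s; have hi : (Num.truncn s)%:R <= s by rewrite truncn_le ltW.
exists (Num.truncn s).+1; split=> //.
  by rewrite st lerXn2r ?nnegrE ?ltW.
have -> : t `^ (- z / 2) = (s `^ z)^-1.
  by rewrite st -powR_mulrn ?(ltW s0) // -powRrM -powRN; congr (_ `^ _); field.
rewrite mulrC ler_pdivrMr ?powR_gt0 // -powRM ?(ltW s0) //.
by apply: ge0_ler_powR; rewrite ?nnegrE ?mulr_ge0 ?(ltW s0) // -natr1; lra.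
Qed.

Section HeatSum.
Context {R : realType} {V : countType} {A : {fset V}}.
Variables (e : rel V) (T : 'End(l2 R A)).
Variables (I : finType) (phi : I -> l2 R A) (lam : I -> R).
Hypothesis phiP : forall i, T (phi i) = lam i *: phi i.
Hypothesis frame : forall f, f = \sum_i inner e f (phi i) *: phi i.
Variables (z c1 c2 c3 c4 c5 D l : R).
Hypotheses (c1_gt0 : 0 < c1) (c2_gt0 : 0 < c2) (c3_gt0 : 0 < c3)
  (c5_gt0 : 0 < c5) (l_ge0 : 0 <= l).
Hypothesis heatT : heat_kernel_bound e z c1 c2 c3 c4 c5 T.
Hypothesis lam_ge : forall i, phi i != 0 -> l <= lam i.
Hypothesis deg_ge1 : forall x : A, 1 <= (deg e (val x))%:R :> R.
Hypothesis deg_leD : forall x : A, (deg e (val x))%:R <= D.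
Local Notation heat := (heat_kernel T).
Local Notation d x y := (dist e (val x) (val y)).
Implicit Types (t : R) (x y : A).

Lemma heatTP t x y : 0 < t ->
  [/\ (1 <= d x y)%N -> (d x y)%:R <= t ->
        `|heat t x y| <= c1 * t `^ (- z / 2) * expR (- c2 * (d x y)%:R ^+ 2 / t),
      (1 <= d x y)%N -> t < (d x y)%:R ->
        `|heat t x y| <= c3 * expR (- c4 * (d x y)%:R)
    & x = y -> `|heat t x y| <= c5 * t `^ (- z / 2)].
Proof. by move=> t0; exact: heatT. Qed.

(** Geometric mean of the Gaussian bound and the spectral bound, which halves both exponents. The
    latter applies the diagonal bound at time [t / 2] and decay over the remaining [t / 2], whence
    the power of [2^-1]. *)
Lemma heat_le_near t x y : 0 < t -> (0 < d x y)%N -> (d x y)%:R <= t ->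
  `|heat t x y| <= (c1 + D * c5 * 2^-1 `^ (- z / 2)) * t `^ (- z / 2) *
     (expR (- (c2 / 2 * ((d x y)%:R ^+ 2 / t))) * expR (- (t * l / 4))).
Proof.
move=> t0 d0 dt; have D0 : 0 <= D by apply: le_trans (deg_leD x).
have [/(_ d0 dt) near _ _] := heatTP x y t0.
have diag (u : A) : heat t u u <=
    expR (- (t * l / 2)) * (c5 * (2^-1 `^ (- z / 2) * t `^ (- z / 2))).
  apply: le_trans (heat_diag_decay phiP frame u lam_ge (_ : t / 2 <= t)) _.
    by rewrite ler_pdivrMr //; lra.
  have -> : - (t - t / 2) * l = - (t * l / 2) by field.
  rewrite ler_wpM2l ?expR_ge0 //.
  have [_ _ /(_ erefl)] := heatTP u u (divr_gt0 t0 (ltr0n R 2)).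
  have -> : (t / 2) `^ (- z / 2) = 2^-1 `^ (- z / 2) * t `^ (- z / 2).
    by rewrite mulrC powRM ?(ltW t0) ?invr_ge0.
  by apply: le_trans; exact: ler_norm.
have := heat_offdiag_le phiP frame x y deg_ge1 deg_leD diag => off.
rewrite mulrDl; apply: le_mul_of_sqr; rewrite ?mulr_ge0 ?powR_ge0 ?expR_ge0 ?normr_ge0 //.
all: rewrite ?(ltW c1_gt0) ?(ltW c5_gt0) //.
  rewrite -expRM_natl; apply: le_trans near _; rewrite le_eqVlt; apply/predU1P; left.
  by congr (_ * expR _); field; rewrite gt_eqF.
apply: le_trans off _; rewrite le_eqVlt; apply/predU1P; left.
rewrite -expRM_natl; have -> : 2%:R * - (t * l / 4) = - (t * l / 2) by field.
ring.
Qed.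

(** Same interpolation, but with the diagonal bounded by [expR (- t * l)]: a factor [t ^ (- z / 2)]
    would blow up at small times. *)
Lemma heat_le_far t x y : 0 < t -> (0 < d x y)%N -> t < (d x y)%:R ->
  `|heat t x y| <= (c3 + D) *
     (expR (- (c4 / 2 * (d x y)%:R)) * expR (- (t * l / 4))).
Proof.
move=> t0 d0 td; have D0 : 0 <= D by apply: le_trans (deg_leD x).
have [_ /(_ d0 td) far _] := heatTP x y t0.
have diag (u : A) := heat_diag_le phiP frame u lam_ge (ltW t0).
have := heat_offdiag_le phiP frame x y deg_ge1 deg_leD diag => off.
apply: le_mul_of_sqr; rewrite ?expR_ge0 ?normr_ge0 ?(ltW c3_gt0) //.
  rewrite -expRM_natl; apply: le_trans far _; rewrite le_eqVlt; apply/predU1P; left.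
  by congr (_ * expR _); field.
apply: le_trans off _; rewrite -expRM_natl ler_wpM2l // ler_expR.
have := mulr_ge0 (ltW t0) l_ge0; lra.
Qed.

Lemma heat_le_diag t x : 0 < t -> `|heat t x x| <= expR (- (t * l / 4)).
Proof.
move=> t0; rewrite ger0_norm; last exact: heat_diag_ge0 phiP frame _ _.
apply: le_trans (heat_diag_le phiP frame x lam_ge (ltW t0)) _.
rewrite ler_expR; have := mulr_ge0 (ltW t0) l_ge0; lra.
Qed.

(** The three summands of the constant come from [y = x], from [d <= t] and from [d > t]. *)
Lemma heat_sum_le M1 M2 : connected_graph e -> 0 <= z -> 0 <= M1 -> 0 <= M2 ->
  (forall x n, (0 < n)%N ->
    \sum_(y : A) expR (- (c2 / 2 * (d x y %/ n)%:R)) <= M1 * n%:R `^ z) ->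
  (forall x, \sum_(y : A) expR (- (c4 / 2 * (d x y)%:R)) <= M2) ->
  forall t x, 0 < t -> \sum_y `|heat t x y| <=
    (1 + (c1 + D * c5 * 2^-1 `^ (- z / 2)) * (M1 * 2 `^ z) + (c3 + D) * M2) *
      expR (- (t * l / 4)).
Proof.
move=> conn z0 M10 M20 sum1 sum2 t x t0.
set K1 := c1 + _; set K2 := c3 + D; set v := expR _.
have D0 : 0 <= D by apply: le_trans (deg_leD x).
have K10 : 0 <= K1.
  by rewrite addr_ge0 ?mulr_ge0 ?powR_ge0 ?(ltW c1_gt0) ?(ltW c5_gt0).
have K20 : 0 <= K2 by rewrite addr_ge0 ?(ltW c3_gt0).
have v0 : 0 <= v := expR_ge0 _.
(* The near regime has [1 <= d <= t], so it is empty for [t < 1]; the value 0 then removes the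
   singular power of [t]. *)
pose th : R := if 1 <= t then t `^ (- z / 2) else 0.
have th0 : 0 <= th by rewrite /th; case: ifP => // _; exact: powR_ge0.
have [n [n0 tn thn]] : exists n : nat, [/\ (0 < n)%N, 1 <= t -> t <= n%:R ^+ 2
    & th * n%:R `^ z <= 2 `^ z].
  rewrite /th; case: ifPn => [/(sqrt_scale z0) [n [? ? ?]]|_]; first by exists n.
  by exists 1%N; rewrite mul0r powR_ge0; split=> // t1; rewrite expr1n.
pose F1 y := expR (- (c2 / 2 * (d x y %/ n)%:R)).
pose F2 y := expR (- (c4 / 2 * (d x y)%:R)).
have F10 y : 0 <= F1 y := expR_ge0 _.
have F20 y : 0 <= F2 y := expR_ge0 _.
have pointwise y : `|heat t x y| <=
    ((x == y)%:R + K1 * (th * F1 y) + K2 * F2 y) * v.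
  have P1 : 0 <= K1 * (th * F1 y) by rewrite !mulr_ge0.
  have P2 : 0 <= K2 * F2 y by rewrite mulr_ge0.
  have [d0|d0] := posnP (d x y).
    have xy : x = y by apply: val_inj; exact: dist_eq0 d0.
    subst y; apply: le_trans (heat_le_diag x t0) _.
    by rewrite -/v -[leLHS]mul1r ler_wpM2r // eqxx -addrA lerDl addr_ge0.
  have [dt|td] := lerP (d x y)%:R t.
    have t1 : 1 <= t by apply: le_trans dt; rewrite ler1n.
    apply: le_trans (heat_le_near t0 d0 dt) _.
    apply: (@le_trans _ _ (K1 * (th * F1 y) * v)); last first.
      by rewrite ler_wpM2r // -addrA addrCA lerDl addr_ge0 ?ler0n.
    rewrite -/K1 mulrA -/v; apply: ler_wpM2r => //.
    rewrite -mulrA ler_wpM2l // /th t1 ler_wpM2l ?powR_ge0 // ler_expR lerN2.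
    rewrite ler_wpM2l ?divr_ge0 ?(ltW c2_gt0) //.
    (* With [q = d %/ n], the chain [q * t <= q * n ^ 2 <= (q * n) ^ 2 <= d ^ 2] turns the Gaussian
       into an exponential in [q]. *)
    rewrite ler_pdivlMr //; apply: le_trans (ler_wpM2l _ (tn t1)) _; first by [].
    rewrite -natrX -natrM -natrX ler_nat.
    have := leq_trunc_div (d x y) n; move: (d x y %/ n)%N => q qn.
    apply: (@leq_trans ((q * n) ^ 2)); last by rewrite leq_sqr.
    rewrite expnMn leq_pmul2r ?expn_gt0 ?n0 // -mulnn.
    by case: q {qn} => // q; rewrite leq_pmulr.
  apply: le_trans (heat_le_far t0 d0 td) _.
  rewrite -/K2 mulrA -/v; apply: ler_wpM2r => //.
  by rewrite -/(F2 y) lerDr addr_ge0 ?ler0n.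
apply: le_trans (ler_sum _ (fun y _ => pointwise y)) _.
rewrite -mulr_suml; apply: ler_wpM2r => //.
rewrite !big_split /= -!mulr_sumr; apply: lerD; [apply: lerD|].
- by rewrite (bigD1 x) //= eqxx big1 ?addr0 // => y; rewrite eq_sym => /negPf ->.
- rewrite ler_wpM2l //; apply: le_trans (ler_wpM2l th0 (sum1 x n n0)) _.
  by rewrite mulrCA ler_wpM2l.
- by rewrite ler_wpM2l //; exact: sum2.
Qed.

End HeatSum.

Theorem theorem4 (R : realType) (z CU : R) (hz : 1 <= z) (hCU : 0 < CU) :
  (forall (V : countType) (e : rel V) (AA : set {fset V})
      (H : forall A : {fset V}, 'End(l2 R A)),
    setting z CU e AA H ->
    forall A, AA A ->
      1 <= smallest_eigenvalue (H A) * supnorm (landscape (H A)))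
  /\
  (forall c1 c2 c3 c4 c5 : R,
    0 < c1 -> 0 < c2 -> 0 < c3 -> 0 < c4 -> 0 < c5 ->
    exists C : R,
      forall (V : countType) (e : rel V) (AA : set {fset V})
        (H : forall A : {fset V}, 'End(l2 R A)),
      setting z CU e AA H ->
      (forall A, AA A -> heat_kernel_bound e z c1 c2 c3 c4 c5 (H A)) ->
      forall A, AA A ->
        smallest_eigenvalue (H A) * supnorm (landscape (H A)) <= C).
Proof.
split=> [V e AA H S A AAA | c1 c2 c3 c4 c5 c1p c2p c3p c4p c5p].
  case: S => Vinf _ conn bdeg _ /(_ A AAA) A0 /(_ A AAA) saH /(_ A AAA) posH /(_ A AAA) invH.
  have deg0 (x : A) : (0 < deg e (val x))%N by exact: (deg_gt0 conn _ Vinf bdeg).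
  have [I [phi [lam [phiP frame]]]] := self_adjoint_eigenframe deg0 saH.
  have [ev _] := smallest_eigenvalueP saH phiP frame A0.
  exact: (inv_eigenvalue_le_landscape posH invH ev).
have z0 : 0 <= z by lra.
(* The rates are halved by the geometric mean. Both constants are fixed before any graph is
   introduced, which makes [C] uniform. *)
have [M1 M10 sum1] := @sum_ball_exp_le R (c2 / 2) z CU (divr_gt0 c2p (ltr0n R 2)) hCU z0.
have [M2 M20 sum2] := @sum_ball_exp_le R (c4 / 2) z CU (divr_gt0 c4p (ltr0n R 2)) hCU z0.
set M := 1 + (c1 + CU * c5 * 2^-1 `^ (- z / 2)) * (M1 * 2 `^ z) + (c3 + CU) * M2.
have M_ge1 : 1 <= M.
  by rewrite /M -addrA lerDl !(addr_ge0, mulr_ge0) ?powR_ge0 ?(ltW c1p)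
    ?(ltW c3p) ?(ltW c5p) ?(ltW hCU).
exists (16 * M ^+ 2) => V e AA H S heatH A AAA.
case: S => Vinf _ conn bdeg growth /(_ A AAA) A0 /(_ A AAA) saH /(_ A AAA) posH _.
have deg0 (x : A) : (0 < deg e (val x))%N by exact: (deg_gt0 conn _ Vinf bdeg).
have deg1 (x : A) : 1 <= (deg e (val x))%:R :> R by rewrite ler1n.
have degD (x : A) : (deg e (val x))%:R <= CU by exact: (deg_le conn _ growth).
have [I [phi [lam [phiP frame]]]] := self_adjoint_eigenframe deg0 saH.
have [ev lev] := smallest_eigenvalueP saH phiP frame A0.
have l0 := positive_eigenvalue_gt0 posH ev.
have heatM := heat_sum_le phiP frame c1p c2p c3p c5p (ltW l0) (heatH A AAA)
  lev deg1 degD conn z0 M10 M20.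
rewrite mulrC -ler_pdivlMr //.
apply: (landscape_le saH phiP frame l0 M_ge1 (positive_lker0 posH)).
apply: heatM => [x n n0|x]; first exact: sum1.
(* The far part has no time scale, so it uses shells of width 1. *)
have := sum2 V e A (val x) 1%N growth isT; rewrite powR1 mulr1.
by under eq_bigr do rewrite divn1.
Qed.
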